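(* For every integer $k\ge 1$, define the formal power series $$\overline{C}_k(q)=(-1)^{k-1}\Biggl(1-\frac{1}{(q;q)_\infty}\sum_{n=-k}^{k}(-1)^n q^{n(3n-1)/2}\Biggr)\prod_{n=1}^{\infty}\bigl(1-q^{2N_n}\bigr).$$ Then $\overline{C}_k(q)$ has nonnegative coefficients for all $k\ge 1$. Furthermore, writing $\overline{C}_k(q)=\sum_{n\ge 0}\overline{c}_k(n)q^n$, we have $\overline{c}_k(n)>0$ if and only if $n\ge g_k+(2k+1)$, where $g_k=\frac{k(3k+1)}{2}$.
   Context: All series are formal power series in $q$ with integer coefficients. $(a;q)_\infty:=\prod_{i\ge 0}(1-aq^i)$, so $(q;q)_\infty=\prod_{m\ge 1}(1-q^m)$. For a positive integer $m$, $\nu_2(m)=\max\{a\ge 0: 2^a\mid m\}$ is the $2$-adic valuation, and $N_m=m\bigl(1+\tfrac{\nu_2(m)}{2}\bigr)$, so that $2N_m=m(\nu_2(m)+2)$ is a positive integer. For $k\ge 1$, $g_k:=\frac{k(3k+1)}{2}$. *)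

(* Defs.v *)
From HB Require Import structures.
From mathcomp Require Import all_boot all_order all_algebra.
From mathcomp Require Import ring.
From mathcomp Require Import boolp classical_sets.
Set Implicit Arguments.
Unset Strict Implicit.
Unset Printing Implicit Defensive.
Import Order.TTheory GRing.Theory Num.Theory.
Local Open Scope ring_scope.

(* The ring Z[[q]]; the coercion makes [f n] the coefficient of q^n in f. *)
Record fps := Fps { fps_coef :> nat -> int }.

Lemma fpsP (f g : fps) : (forall n, f n = g n) <-> f = g.
Proof.
split=> [|-> //]; case: f => f; case: g => g /= fg.
by congr Fps; apply/funext.
Qed.

HB.instance Definition _ := gen_eqMixin fps.
HB.instance Definition _ := gen_choiceMixin fps.

Definition fps_zero := Fps (fun=> 0).
Definition fps_one := Fps (fun n => (n == 0%N)%:R).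
Definition fps_opp (f : fps) := Fps (fun n => - f n).
Definition fps_add (f g : fps) := Fps (fun n => f n + g n).
Definition fps_mul (f g : fps) := Fps (fun n => \sum_(i < n.+1) f i * g (n - i)%N).

Fact fps_addA : associative fps_add.
Proof. by move=> f g h; apply/fpsP => n /=; rewrite addrA. Qed.
Fact fps_addC : commutative fps_add.
Proof. by move=> f g; apply/fpsP => n /=; rewrite addrC. Qed.
Fact fps_add0 : left_id fps_zero fps_add.
Proof. by move=> f; apply/fpsP => n /=; rewrite add0r. Qed.
Fact fps_addN : left_inverse fps_zero fps_opp fps_add.
Proof. by move=> f; apply/fpsP => n /=; rewrite addNr. Qed.

HB.instance Definition _ :=
  GRing.isZmodule.Build fps fps_addA fps_addC fps_add0 fps_addN.

Definition fps_trunc n (f : fps) : {poly int} := \poly_(i < n.+1) f i.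

Lemma coef_fps_trunc n (f : fps) i : (i <= n)%N -> (fps_trunc n f)`_i = f i.
Proof. by move=> le_in; rewrite coef_poly ltnS le_in. Qed.

Lemma coef_fps_truncM n f g m : (m <= n)%N ->
  (fps_trunc n f * fps_trunc n g)`_m = fps_mul f g m.
Proof.
move=> le_mn; rewrite coefM; apply: eq_bigr => i _.
have le_im : (i <= m)%N by rewrite -ltnS.
rewrite !coef_fps_trunc //; first exact: leq_trans (leq_subr _ _) le_mn.
exact: leq_trans le_mn.
Qed.

Fact fps_mulA : associative fps_mul.
Proof.
move=> f g h; apply/fpsP => n.
have -> : fps_mul f (fps_mul g h) n =
    (fps_trunc n f * (fps_trunc n g * fps_trunc n h))`_n.
  rewrite coefM; apply: eq_bigr => i _.
  by rewrite coef_fps_trunc -1?ltnS // coef_fps_truncM ?leq_subr.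
rewrite mulrA coefM; apply: eq_bigr => i _.
by rewrite coef_fps_truncM -1?ltnS // coef_fps_trunc ?leq_subr.
Qed.
Fact fps_mulC : commutative fps_mul.
Proof.
by move=> f g; apply/fpsP => n; rewrite -!(@coef_fps_truncM n) // mulrC.
Qed.
Fact fps_mul1 : left_id fps_one fps_mul.
Proof.
move=> f; apply/fpsP => n /=; rewrite big_ord_recl /= mul1r subn0.
by rewrite big1 ?addr0 // => i _; rewrite mul0r.
Qed.
Fact fps_mulDl : left_distributive fps_mul fps_add.
Proof.
move=> f g h; apply/fpsP => n /=; rewrite -big_split /=.
by apply: eq_bigr => i _; rewrite mulrDl.
Qed.
Fact fps_one_neq0 : fps_one != 0.
Proof. by apply/eqP => /(congr1 (fun f : fps => f 0%N)). Qed.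

HB.instance Definition _ := GRing.Zmodule_isComNzRing.Build fps
  fps_mulA fps_mulC fps_mul1 fps_mulDl fps_one_neq0.

(* The first n.+1 coefficients of 1 / f, found by solving f * g = 1 degree by
   degree. *)
Fixpoint fps_inv_seq (f : fps) (n : nat) : seq int :=
  if n is m.+1 then
    let s := fps_inv_seq f m in
    rcons s (- (f 0%N)^-1 * \sum_(i < m.+1) f i.+1 * s`_(m - i))
  else [:: (f 0%N)^-1].

Definition fps_unit : {pred fps} := fun f => f 0%N \is a GRing.unit.
(* Off the units the inverse is the identity, as unitRingType requires. *)
Definition fps_inv (f : fps) : fps :=
  if f \in fps_unit then Fps (fun n => (fps_inv_seq f n)`_n) else f.

Lemma size_fps_inv_seq f n : size (fps_inv_seq f n) = n.+1.
Proof. by elim: n => //= n IHn; rewrite size_rcons IHn. Qed.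

Lemma nth_fps_inv_seq f n i : (i <= n)%N ->
  (fps_inv_seq f n)`_i = (fps_inv_seq f i)`_i.
Proof.
elim: n => [|n IHn]; first by rewrite leqn0 => /eqP->.
rewrite leq_eqVlt => /predU1P[->//|lt_in].
by rewrite /= nth_rcons size_fps_inv_seq lt_in IHn.
Qed.

Fact fps_mulVx : {in fps_unit, left_inverse 1 fps_inv *%R}.
Proof.
move=> f Uf; rewrite mulrC; apply/fpsP => -[|n].
  by rewrite /= /fps_inv Uf big_ord1 /= divrr.
rewrite /= /fps_inv Uf /= big_ord_recl /= subn0 nth_rcons size_fps_inv_seq.
rewrite ltnn eqxx mulrA mulrN divrr // mulN1r addrC; apply/eqP.
rewrite subr_eq0; apply/eqP/eq_bigr => i _.
by rewrite /bump /= add1n subSS [in RHS]nth_fps_inv_seq ?leq_subr.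
Qed.
Fact fps_unitPl (f g : fps) : g * f = 1 -> fps_unit f.
Proof.
move/(congr1 (fun h : fps => h 0%N)); rewrite /= big_ord1 /= => gf1.
by apply/unitrPr; exists (g 0%N); rewrite mulrC.
Qed.
Fact fps_inv_out : {in [predC fps_unit], fps_inv =1 id}.
Proof. by move=> f /negbTE Uf; rewrite /fps_inv [f \in _]Uf. Qed.

HB.instance Definition _ := GRing.ComNzRing_hasMulInverse.Build fps
  fps_mulVx fps_unitPl fps_inv_out.

Lemma fps_unitE (f : fps) : (f \is a GRing.unit) = (f 0%N \is a GRing.unit).
Proof. by []. Qed.

Lemma coef_fps0 n : (0 : fps) n = 0. Proof. by []. Qed.
Lemma coef_fps1 n : (1 : fps) n = (n == 0%N)%:R. Proof. by []. Qed.
Lemma coef_fpsN (f : fps) n : (- f) n = - f n. Proof. by []. Qed.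
Lemma coef_fpsD (f g : fps) n : (f + g) n = f n + g n. Proof. by []. Qed.
Lemma coef_fpsM (f g : fps) n : (f * g) n = \sum_(i < n.+1) f i * g (n - i)%N.
Proof. by []. Qed.

Arguments fps_coef : simpl never.

Definition fps_q : fps := Fps (fun n => (n == 1%N)%:R).

Lemma coef_fps_q n : fps_q n = (n == 1%N)%:R. Proof. by []. Qed.

Lemma coef_fps_q_exp m n : (fps_q ^+ m) n = (n == m)%:R.
Proof.
elim: m n => [|m IHm] n; first by rewrite expr0.
rewrite exprS coef_fpsM; case: n => [|n].
  by rewrite big_ord1 coef_fps_q mul0r.
rewrite 2!big_ord_recl big1 => [|i _]; last by rewrite coef_fps_q mul0r.
by rewrite !coef_fps_q mul0r mul1r add0r addr0 subSS subn0 IHm.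
Qed.

(* q-adic convergence: every coefficient is eventually constant. *)
Definition fps_cvg (u : nat -> fps) (f : fps) :=
  forall m, exists N, forall n, (N <= n)%N -> u n m = f m.

(* A coefficient that does not stabilise is given the value 0. *)
Definition fps_lim (u : nat -> fps) : fps :=
  Fps (fun m => xget 0 [set c | exists N, forall n, (N <= n)%N -> u n m = c]).

Lemma fps_cvg_lim u f : fps_cvg u f -> fps_lim u = f.
Proof.
move=> uf; apply/fpsP => m /=; apply: xget_unique; first exact: uf.
move=> c [N uc]; have [M uM] := uf m.
by rewrite -(uc (maxn M N)) ?leq_maxr // uM ?leq_maxl.
Qed.

Lemma coef_fps_mul_sub (f g : fps) e m : (m < e)%N ->
  (f * (1 - g * fps_q ^+ e)) m = f m.
Proof.
move=> lt_me; rewrite mulrBr mulr1 coef_fpsD coef_fpsN mulrA coef_fpsM big1.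
  by rewrite subr0.
move=> i _; rewrite coef_fps_q_exp; case: eqP => [mi|_]; last by rewrite mulr0.
by have := leq_subr i m; rewrite mi leqNgt lt_me.
Qed.

Lemma coef_fps_prod (a : nat -> fps) (e : nat -> nat) j m N :
    (forall n, (j <= n -> n <= e n)%N) -> (j <= m.+1)%N -> (m < N)%N ->
  (\prod_(j <= n < N) (1 - a n * fps_q ^+ e n)) m =
  (\prod_(j <= n < m.+1) (1 - a n * fps_q ^+ e n)) m.
Proof.
move=> le_e le_jm; elim: N => // N IHN; rewrite ltnS leq_eqVlt.
case/predU1P=> [->//|lt_mN]; have le_jN : (j <= N)%N := leq_trans le_jm lt_mN.
by rewrite big_nat_recr //= coef_fps_mul_sub ?IHN // (leq_trans lt_mN) ?le_e.
Qed.

Lemma fps_prod_cvg (a : nat -> fps) (e : nat -> nat) j :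
    (forall n, (j <= n -> n <= e n)%N) -> (j <= 1)%N ->
  let u N := \prod_(j <= n < N) (1 - a n * fps_q ^+ e n) in
  fps_cvg u (fps_lim u).
Proof.
move=> le_e le_j1 u.
have uf : fps_cvg u (Fps (fun m => u m.+1 m)).
  by move=> m; exists m.+1 => n lt_mn; apply: coef_fps_prod (leq_trans le_j1 _) _.
by rewrite (fps_cvg_lim uf).
Qed.

(* (a; q)_oo *)
Definition qpoch (a : fps) : fps :=
  fps_lim (fun N => \prod_(0 <= i < N) (1 - a * fps_q ^+ i)).

Lemma qpoch_cvg a : fps_cvg (fun N => \prod_(0 <= i < N) (1 - a * fps_q ^+ i))
  (qpoch a).
Proof. exact: (@fps_prod_cvg (fun=> a) id). Qed.

Lemma qpoch_q_unit : qpoch fps_q \is a GRing.unit.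
Proof.
rewrite fps_unitE; have [N /(_ N (leqnn N)) <-] := qpoch_cvg fps_q 0.
suff -> : (\prod_(0 <= i < N) (1 - fps_q * fps_q ^+ i)) 0%N = 1.
  exact: unitr1.
elim: N => [|N IHN]; first by rewrite big_geq.
by rewrite big_nat_recr //= -exprS -[_ ^+ N.+1]mul1r coef_fps_mul_sub.
Qed.

Definition nu2 (m : nat) : nat := logn 2 m.

Definition NN (m : nat) : rat := m%:R * (1 + (nu2 m)%:R / 2).

(* 2 N_m as a natural number, to be used as an exponent. *)
Definition twoNN (m : nat) : nat := (m * (nu2 m + 2))%N.

Lemma twoNNE m : (twoNN m)%:R = 2 * NN m.
Proof.
rewrite /NN /twoNN natrM natrD mulrCA [2 * (1 + _)]mulrDr mulr1.
by rewrite [2 * (_ / 2)]mulrC mulfVK // addrC.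
Qed.

Definition prodNN : fps :=
  fps_lim (fun M => \prod_(1 <= n < M) (1 - fps_q ^+ twoNN n)).

Lemma prodNN_cvg :
  fps_cvg (fun M => \prod_(1 <= n < M) (1 - fps_q ^+ twoNN n)) prodNN.
Proof.
have := @fps_prod_cvg (fun=> 1) twoNN 1; rewrite /prodNN.
under eq_fun do under eq_bigr do rewrite mul1r.
by apply=> // n _; rewrite /twoNN addn2 leq_pmulr.
Qed.

(* n (3 n - 1) / 2 is a natural number for every integer n. *)
Definition pent (n : int) : nat := `|(n * (3 * n - 1) %/ 2)%Z|%N.

Lemma pentE (n : int) : 2 * (pent n)%:Z = n * (3 * n - 1).
Proof.
have n3_ge0 : 0 <= n * (3 * n - 1).
  have [n_le0|n_gt0] := leP n 0.
    by rewrite mulr_le0 // subr_le0 (le_trans _ ler01) // mulr_ge0_le0.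
  rewrite mulr_ge0 ?(ltW n_gt0) // subr_ge0.
  by apply: (@le_trans _ _ n); rewrite ?gtz0_ge1 // ler_peMl // ltW.
have n3_even : (2 %| n * (3 * n - 1))%Z.
  have := modz_ge0 n (isT : 2 != 0 :> int).
  have := ltz_pmod n (isT : 0 < 2 :> int).
  have := divz_eq n 2; set m := (n %/ 2)%Z.
  case: (n %% 2)%Z => [[|[|]]|] // -> _ _; apply/dvdzP.
    by exists (m * (3 * (m * 2) - 1)); ring.
  by exists ((m * 2 + 1) * (3 * m + 1)); ring.
by rewrite /pent gez0_abs ?divz_ge0 // mulrC divzK.
Qed.

(* The bilateral sum over -k <= n <= k is indexed by n = i - k, 0 <= i <= 2k. *)
Definition pent_sum (k : nat) : fps :=
  \sum_(0 <= i < (2 * k).+1%N)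
     let n : int := i%:Z - k%:Z in (-1) ^ n * fps_q ^+ pent n.

Definition Cbar (k : nat) : fps :=
  (-1) ^+ (k - 1)%N * (1 - (qpoch fps_q)^-1 * pent_sum k) * prodNN.

Definition g (k : nat) : nat := ((k * (3 * k + 1)) %/ 2)%N.

(* Main.v *)
(* The quotient F of the product over n of 1 - q^(2 N_n) by (q; q)_oo is the
   product of the polynomials 1 + q^n + ... + q^(n (nu_2(n) + 1)). In (1 - q) F
   the factor 1 - q telescopes against those with n = 1, 2, 6, 18, ..., so
   (1 - q) F is the product of the other ones: its coefficients are nonnegative,
   and positive at 0 and at every odd m >= 3. Hence the coefficients of F
   increase weakly, and strictly over any gap of at least 3. By the pentagonal
   number theorem, Cbar k is the tail over |n| > k of the pentagonal series, with
   alternating signs, times F; each coefficient is thus an alternating sum of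
   decreasing terms, the first of which is nonzero exactly in degrees at least
   pent (k + 1) = g k + (2 k + 1). *)
Require Import Defs.
From mathcomp Require Import all_boot all_order all_algebra.
From mathcomp Require Import ring zify.
Set Implicit Arguments.
Unset Strict Implicit.
Unset Printing Implicit Defensive.
Import Order.TTheory GRing.Theory Num.Theory.
Local Open Scope ring_scope.

(** * Coefficients of products and sums *)

Lemma coef_fps_mulq (f : fps) e m :
  (f * fps_q ^+ e) m = if (e <= m)%N then f (m - e)%N else 0.
Proof.
rewrite mulrC coef_fpsM; case: leqP => [le_em|lt_me].
  rewrite (bigD1 (inord e)) //= inordK // coef_fps_q_exp eqxx mul1r.
  rewrite big1 ?addr0 // => i; rewrite -val_eqE /= inordK // => /negbTE ne_ie.
  by rewrite coef_fps_q_exp ne_ie mul0r.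
rewrite big1 // => i _; rewrite coef_fps_q_exp; case: eqP => [ie|_]; last first.
  by rewrite mul0r.
by have := ltn_ord i; rewrite ie ltnS leqNgt lt_me.
Qed.

Lemma coef_fps_sum (I : Type) (r : seq I) (P : pred I) (G : I -> fps) m :
  (\sum_(i <- r | P i) G i) m = \sum_(i <- r | P i) G i m.
Proof. by elim/big_rec2: _ => // i x y _ <-; rewrite coef_fpsD. Qed.

Lemma coef_fps_signM s (f : fps) m : ((-1) ^+ s * f) m = (-1) ^+ s * f m.
Proof.
elim: s => [|s IHs]; first by rewrite !expr0 !mul1r.
by rewrite !exprS -!mulrA !mulN1r coef_fpsN IHs.
Qed.

(** * Congruence modulo q^M and the pentagonal number theorem *)

Definition fps_eqmod M (f g : fps) := forall m, (m < M)%N -> f m = g m.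

Lemma fps_eqmodM M f f' g g' :
  fps_eqmod M f f' -> fps_eqmod M g g' -> fps_eqmod M (f * g) (f' * g').
Proof.
move=> ff' gg' m lt_mM; rewrite !coef_fpsM; apply: eq_bigr => i _.
rewrite ff' ?gg' //; first exact: leq_ltn_trans (leq_subr _ _) lt_mM.
by apply: leq_trans lt_mM; rewrite ltnS -ltnS.
Qed.

Definition qfact M : fps := \prod_(1 <= n < M) (1 - fps_q ^+ n).

Lemma qpoch_eqmod M : fps_eqmod M (qfact M) (qpoch fps_q).
Proof.
(* Beyond [N] the coefficient is that of the limit; beyond [M] only factors congruent to 1 modulo
   q^M are added. *)
move=> m lt_mM; have [N /(_ (maxn N M) (leq_maxl _ _)) <-] := qpoch_cvg fps_q m.
have -> : \prod_(0 <= i < maxn N M) (1 - fps_q * fps_q ^+ i) =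
    \prod_(1 <= n < (maxn N M).+1) (1 - 1 * fps_q ^+ n).
  by rewrite big_add1 /=; apply: eq_bigr => i _; rewrite mul1r -exprS.
rewrite (coef_fps_prod (fun=> 1) (e := id)) //; last first.
  by rewrite ltnS (leq_trans (ltnW lt_mM)) ?leq_maxr.
rewrite -(coef_fps_prod (fun=> 1) (e := id) (N := M)) //.
by congr (fps_coef _ _); apply: eq_bigr => i _; rewrite mul1r.
Qed.

Lemma prodNN_eqmod M :
  fps_eqmod M (\prod_(1 <= n < M) (1 - fps_q ^+ twoNN n)) prodNN.
Proof.
move=> m lt_mM; have [N /(_ (maxn N M) (leq_maxl _ _)) <-] := prodNN_cvg m.
have le_e n : (1 <= n -> n <= twoNN n)%N by rewrite /twoNN addn2 leq_pmulr.
have mul1 K : \prod_(1 <= n < K) (1 - fps_q ^+ twoNN n) =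
    \prod_(1 <= n < K) (1 - 1 * fps_q ^+ twoNN n) :> fps.
  by apply: eq_bigr => i _; rewrite mul1r.
rewrite !mul1 (coef_fps_prod (fun=> 1)) //.
by rewrite -(coef_fps_prod (fun=> 1) (N := maxn N M)) // leq_max lt_mM orbT.
Qed.

(* Shanks' finite form of the pentagonal number theorem. The factor
   [\prod_(s.+1 <= i < n.+1) (1 - x ^+ i)] is (x; x)_n / (x; x)_s. *)
Lemma shanks_step (R : comNzRingType) (x : R) n :
  let T n s : R := (-1) ^+ s * \prod_(s.+1 <= i < n.+1) (1 - x ^+ i)
                 * x ^+ (n * s + 'C(s.+1, 2)) in
  \sum_(s < n.+2) T n.+1 s = \sum_(s < n.+1) T n s
    + (-1) ^+ n.+1 *
      (x ^+ (n.+1 ^ 2 + 'C(n.+1, 2)) + x ^+ (n.+1 ^ 2 + 'C(n.+2, 2))).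
Proof.
move=> T.
(* [W] is a telescoping certificate. At [t = n] its product is empty, which leaves the first of the
   two new powers of [x]; the second is the term [T n.+1 n.+1]. *)
pose W s : R := (-1) ^+ s * \prod_(s.+1 <= i < n.+1) (1 - x ^+ i)
              * x ^+ (n.+1 * s.+1 + 'C(s.+1, 2)).
have step t : (t <= n)%N -> \sum_(s < t.+1) (T n.+1 s - T n s) = - W t.
  elim: t => [_|t IHt lt_tn].
    rewrite big_ord1 /T /W big_nat_recr //= !muln0 !expr0 !muln1.
    by rewrite bin_small // addn0; ring.
  rewrite big_ord_recr /= IHt 1?ltnW // /T /W.
  rewrite [\prod_(t.+2 <= i < n.+2) _]big_nat_recr //=.
  rewrite [\prod_(t.+1 <= i < n.+1) _]big_ltn //= [in 'C(t.+2, 2)]binS bin1.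
  set P := \prod_(_ <= _ < _) _.
  have -> : (n.+1 * t.+1 = n * t.+1 + t.+1)%N by lia.
  have -> : (n.+1 * t.+2 = n * t.+1 + t.+1 + n.+1)%N by lia.
  by rewrite [(-1) ^+ t.+1]exprS !exprD; ring.
have := step n (leqnn n); rewrite big_split /= sumrN => /(canRL (subrK _)).
rewrite [X in X = _ -> _](_ : _ = \sum_(s < n.+1) T n.+1 s) // => sumT.
rewrite big_ord_recr /= sumT /T /W !big_geq // !mulr1 exprS -!mulnn; ring.
Qed.

Lemma pent_sumS k : pent_sum k.+1 = pent_sum k +
  (-1) ^+ k.+1 * (fps_q ^+ pent k.+1%:Z + fps_q ^+ pent (- k.+1%:Z)).
Proof.
rewrite /pent_sum mulnS addSn big_nat_recl //= big_nat_recr //= sub0r.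
have -> : (2 * k).+2%:Z - k.+1%:Z = k.+1%:Z by lia.
rewrite [(-1) ^ (- _)](_ : _ = (-1) ^+ k.+1); last first.
  by rewrite -invr_expz invr_sign.
rewrite -exprnP; under eq_bigr => i _ do
  have -> : i.+1%:Z - k.+1%:Z = i%:Z - k%:Z by lia.
by ring.
Qed.

Lemma pent_posE n : pent n.+1%:Z = (n.+1 ^ 2 + 'C(n.+1, 2))%N.
Proof.
have := mul_bin_diag n.+1 1; have := pentE n.+1; rewrite /= bin1 -mulnn; lia.
Qed.

Lemma pent_negE n : pent (- n.+1%:Z) = (n.+1 ^ 2 + 'C(n.+2, 2))%N.
Proof.
have := mul_bin_diag n.+2 1; have := pentE (- n.+1%:Z).
by rewrite /= bin1 -mulnn; lia.
Qed.

Lemma pent_posS n : pent n.+2%:Z = (pent n.+1%:Z + 3 * n.+1 + 1)%N.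
Proof. by rewrite !pent_posE [in LHS]binS bin1 -!mulnn; lia. Qed.

Lemma pent_negS n : pent (- n.+2%:Z) = (pent (- n.+1%:Z) + 3 * n.+1 + 2)%N.
Proof. by rewrite !pent_negE [in LHS]binS bin1 -!mulnn; lia. Qed.

Lemma pent_pos_le_neg n : (pent n.+1%:Z <= pent (- n.+1%:Z))%N.
Proof. by rewrite pent_posE pent_negE leq_add2l leq_bin2l. Qed.

Lemma shanks n :
  \sum_(s < n.+1) (-1) ^+ s * \prod_(s.+1 <= i < n.+1) (1 - fps_q ^+ i)
    * fps_q ^+ (n * s + 'C(s.+1, 2)) = pent_sum n.
Proof.
elim: n => [|n IHn].
  by rewrite big_ord1 big_geq // /pent_sum big_nat1 subrr !mulr1.
have /= -> := shanks_step fps_q n.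
by rewrite IHn pent_sumS pent_posE pent_negE.
Qed.

(** In Shanks' sum the term [s = 0] is the partial product (q; q)_n, and every other term is
    divisible by q^(n+1), since n s + s (s + 1) / 2 > n for s > 0. *)
Lemma pent_sum_eqmod n : fps_eqmod n.+1 (pent_sum n) (qpoch fps_q).
Proof.
move=> m lt_mn; rewrite -(qpoch_eqmod lt_mn) -shanks big_ord_recl coef_fpsD.
rewrite muln0 add0n bin_small // !expr0 mul1r mulr1 coef_fps_sum.
rewrite [X in _ + X]big1 ?addr0 // => i _.
rewrite coef_fps_mulq; case: leqP => //= le_m.
have C_gt0 : (0 < 'C((bump 0 i).+1, 2))%N by rewrite bin_gt0 /bump.
have le_n : (n <= n * bump 0 i)%N by rewrite leq_pmulr // /bump.
by move: le_m; lia.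
Qed.

(** * The quotient F as a product of finite geometric sums *)

Definition qgeom n : fps := \sum_(i < nu2 n + 2) (fps_q ^+ n) ^+ i.

Lemma qgeomE n : (1 - fps_q ^+ n) * qgeom n = 1 - fps_q ^+ twoNN n.
Proof. by rewrite -[LHS]opprK -mulNr opprB -subrX1 opprB exprM. Qed.

(** This is the series F. *)
Definition qgeom_prod : fps := (qpoch fps_q)^-1 * prodNN.

Lemma qgeom_prod_eqmod M :
  fps_eqmod M (\prod_(1 <= n < M) qgeom n) qgeom_prod.
Proof.
have -> : \prod_(1 <= n < M) qgeom n =
    (qpoch fps_q)^-1 * (qpoch fps_q * \prod_(1 <= n < M) qgeom n) :> fps.
  by rewrite mulKr ?qpoch_q_unit.
apply: fps_eqmodM => // m lt_mM; rewrite -(prodNN_eqmod lt_mM).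
under [in RHS]eq_bigr do rewrite -qgeomE.
rewrite big_split /=; apply: (fps_eqmodM _ _ lt_mM) => // i lt_iM.
by rewrite (qpoch_eqmod lt_iM).
Qed.

Definition fps_nneg (f : fps) := forall n, 0 <= f n.

Lemma fps_nnegM f g : fps_nneg f -> fps_nneg g -> fps_nneg (f * g).
Proof.
by move=> f0 g0 n; rewrite coef_fpsM sumr_ge0 // => i _; rewrite mulr_ge0.
Qed.

Lemma coef_fpsM_gt0 f g i j :
  fps_nneg f -> fps_nneg g -> 0 < f i -> 0 < g j -> 0 < (f * g) (i + j)%N.
Proof.
move=> f0 g0 fi gj; rewrite coef_fpsM (bigD1 (inord i)) //=.
rewrite inordK ?ltnS ?leq_addr // addKn ltr_wpDr ?mulr_gt0 // sumr_ge0 // => l _.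
by rewrite mulr_ge0.
Qed.

Lemma coef_qgeom n m : qgeom n m = \sum_(i < nu2 n + 2) (m == n * i)%N%:R.
Proof.
by rewrite coef_fps_sum; apply: eq_bigr => i _; rewrite -exprM coef_fps_q_exp.
Qed.

Lemma qgeom_nneg n : fps_nneg (qgeom n).
Proof. by move=> m; rewrite coef_qgeom sumr_ge0. Qed.

Lemma qgeom_gt0 n i : (i < nu2 n + 2)%N -> 0 < qgeom n (n * i)%N.
Proof.
move=> lt_i; rewrite coef_qgeom (bigD1 (Ordinal lt_i)) //= eqxx.
by rewrite ltr_wpDr // sumr_ge0.
Qed.

(* Multiplying [1 - q ^+ e] by the factor of index e gives
   [1 - q ^+ twoNN e]; starting from e = 1, the exponent runs through
   1, 2, 6, 18, ..., and the factors of all the other indices go into H. *)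
Lemma qgeom_prod_telescope M : (0 < M)%N -> exists e H,
  [/\ (M <= e)%N, (e == 1%N) || ~~ odd e,
      (1 - fps_q) * \prod_(1 <= n < M) qgeom n = (1 - fps_q ^+ e) * H,
      fps_nneg H /\ 0 < H 0%N
    & forall m, (2 < m < M)%N -> odd m -> 0 < H m].
Proof.
elim: M => // -[_ _|M /(_ isT) [e [H [le_e e_par defH [H0 H00] Hm]]] _].
  exists 1%N, 1; split=> //; first by rewrite big_geq // mulr1 expr1.
    by split=> // n; rewrite coef_fps1.
  by move=> m; lia.
rewrite big_nat_recr //= mulrA defH.
(* The factor of index [M.+1] either is absorbed into [1 - fps_q ^+ e] or joins [H]. *)
have [def_e|ne_e] := eqVneq e M.+1.
  exists (twoNN e), H; split=> //.
  - rewrite -def_e /twoNN addn2 mulnS -[X in (X < _)%N]addn0 ltn_add2l.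
    by rewrite muln_gt0 def_e.
  - case/orP: e_par => [/eqP->|e_even]; first by rewrite /twoNN /nu2 logn1.
    by rewrite /twoNN oddM (negbTE e_even) orbT.
  - by rewrite -def_e mulrAC qgeomE.
  move=> m /andP[lt_2m]; rewrite ltnS leq_eqVlt.
  case/predU1P=> [def_m|lt_m]; last first.
    by apply: Hm; rewrite lt_2m.
  (* An absorbed index is 1 or even, so it is never an odd [m > 2]. *)
  by move: e_par; rewrite def_e -def_m => /orP[/eqP m1|/negbTE->] //; lia.
have G0 : 0 < qgeom M.+1 0%N by rewrite -(muln0 M.+1) qgeom_gt0 ?addn2.
have G1 : 0 < qgeom M.+1 M.+1.
  by have := @qgeom_gt0 M.+1 1%N; rewrite muln1 addn2; apply.
exists e, (H * qgeom M.+1); split=> //; first by rewrite ltn_neqAle eq_sym ne_e.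
- by rewrite mulrA.
- by split; [apply: fps_nnegM => //; apply: qgeom_nneg
            | apply: (coef_fpsM_gt0 H0 (@qgeom_nneg _) H00 G0)].
move=> m /andP[lt_2m]; rewrite ltnS leq_eqVlt => /predU1P[->|lt_m] m_odd.
  (* The new degree [M.+1] is reached by the constant term of [H] and the linear term of the
     geometric sum in q^(M+1). *)
  by apply: (coef_fpsM_gt0 H0 (@qgeom_nneg _) H00 G1).
rewrite -[m]addn0; apply: (coef_fpsM_gt0 H0 (@qgeom_nneg _) _ G0).
by apply: Hm; rewrite ?lt_2m.
Qed.

(** * Growth of the coefficients of F *)

(** Telescoping over the indices up to [m] yields [e > m], so the factor [1 - fps_q ^+ e] does not
    affect degree [m], where [b] agrees with [H]. *)
Lemma qgeom_prod_diff m :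
  let b := (1 - fps_q) * qgeom_prod in
  0 <= b m /\ ((m == 0%N) || odd m && (2 < m)%N -> 0 < b m).
Proof.
move=> b.
have [e [H [le_e _ defH [H0 H00] Hm]]] := qgeom_prod_telescope (ltn0Sn m).
have -> : b m = H m.
  rewrite /b.
  rewrite -(fps_eqmodM (M := m.+1) (f := 1 - fps_q) _ (@qgeom_prod_eqmod _)) //.
  by rewrite defH mulrC -[fps_q ^+ e]mul1r coef_fps_mul_sub.
split=> // /orP[/eqP-> //|/andP[m_odd m_gt2]].
by apply: Hm; rewrite ?m_gt2 /=.
Qed.

Lemma coef_qgeom_prodS m :
  qgeom_prod m.+1 = qgeom_prod m + ((1 - fps_q) * qgeom_prod) m.+1.
Proof.
rewrite mulrBl mul1r coef_fpsD coef_fpsN mulrC -[fps_q]expr1 coef_fps_mulq /=.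
by rewrite subn1 /= addrC subrK.
Qed.

Lemma qgeom_prod_le m n : (m <= n)%N -> qgeom_prod m <= qgeom_prod n.
Proof.
move/subnK <-; elim: (n - m)%N => // d IHd; rewrite addSn coef_qgeom_prodS.
by rewrite (le_trans IHd) // lerDl; case: (qgeom_prod_diff (d + m).+1).
Qed.

Lemma qgeom_prod_gt0 m : 0 < qgeom_prod m.
Proof.
apply: lt_le_trans (qgeom_prod_le (leq0n m)).
have [_ /(_ isT)] := qgeom_prod_diff 0.
rewrite mulrBl mul1r coef_fpsD coef_fpsN mulrC -[fps_q]expr1.
by rewrite coef_fps_mulq subr0.
Qed.

(** One of [n] and [n.-1] is odd; it exceeds both 2 and [m], and the coefficient jumps strictly
    there. *)
Lemma qgeom_prod_lt m n : (m + 2 < n)%N -> qgeom_prod m < qgeom_prod n.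
Proof.
move=> lt_mn.
have odd_lt l : (2 < l)%N -> odd l -> qgeom_prod l.-1 < qgeom_prod l.
  case: l => // l l_gt2 l_odd; rewrite coef_qgeom_prodS ltrDl.
  by have [_ ->] := qgeom_prod_diff l.+1; rewrite // l_odd l_gt2.
have [n_odd|n_even] := boolP (odd n).
  by apply: le_lt_trans (qgeom_prod_le _) (odd_lt n _ n_odd); lia.
apply: lt_le_trans (qgeom_prod_le (leq_pred n)).
by apply: le_lt_trans (qgeom_prod_le _) (odd_lt n.-1 _ _); lia.
Qed.

(** The coefficient of q^n in q^p F. *)
Definition shifted_coef n p : int :=
  if (p <= n)%N then qgeom_prod (n - p)%N else 0.

Lemma shifted_coef_le n p p' :
  (p <= p')%N -> shifted_coef n p' <= shifted_coef n p.
Proof.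
rewrite /shifted_coef => le_p; case: leqP => [le_p'|_].
  by rewrite (leq_trans le_p le_p') qgeom_prod_le // leq_sub2l.
by case: leqP => // _; rewrite ltW ?qgeom_prod_gt0.
Qed.

Lemma shifted_coef_lt n p p' :
  (p <= n)%N -> (p + 2 < p')%N -> shifted_coef n p' < shifted_coef n p.
Proof.
rewrite /shifted_coef => -> lt_p; case: leqP => [le_p'|_].
  by apply: qgeom_prod_lt; lia.
exact: qgeom_prod_gt0.
Qed.

(** * Alternating sums and the coefficients of [Cbar] *)

(** Splitting off the first term leaves [v 0] minus an alternating sum of the shifted sequence,
    which lies between 0 and [v 1] by induction. *)
Lemma alternating_sum_bounds (R : numDomainType) (v : nat -> R) D :
  (forall d, 0 <= v d) -> (forall d, v d.+1 <= v d) ->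
  0 <= \sum_(d < D) (-1) ^+ d * v d <= v 0%N.
Proof.
elim: D v => [|D IHD] v v0 v_le; first by rewrite big_ord0 lexx /=.
have /andP[] := IHD (fun d => v d.+1) (fun d => v0 d.+1) (fun d => v_le d.+1).
rewrite big_ord_recl expr0 mul1r.
under [in X in _ -> _ -> X]eq_bigr do rewrite lift0 exprS mulN1r mulNr.
rewrite sumrN subr_ge0 => S0 S1.
by rewrite (le_trans S1) //= lerBlDr lerDl.
Qed.

Lemma alternating_sum_ge (R : numDomainType) (v : nat -> R) D :
  (forall d, 0 <= v d) -> (forall d, v d.+1 <= v d) ->
  v 0%N - v 1%N <= \sum_(d < D.+1) (-1) ^+ d * v d.
Proof.
move=> v0 v_le; rewrite big_ord_recl expr0 mul1r lerD2l.
under eq_bigr do rewrite lift0 exprS mulN1r mulNr.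
rewrite sumrN lerN2.
by case/andP: (@alternating_sum_bounds _ (fun d => v d.+1) D
  (fun d => v0 d.+1) (fun d => v_le d.+1)).
Qed.

Lemma pent_sumD k D : pent_sum (k + D)%N = pent_sum k +
  \sum_(d < D) (-1) ^+ (k + d).+1%N *
    (fps_q ^+ pent (k + d).+1%N%:Z + fps_q ^+ pent (- (k + d).+1%:Z)).
Proof.
elim: D => [|D IHD]; first by rewrite addn0 big_ord0 addr0.
by rewrite addnS pent_sumS IHD big_ord_recr addrA.
Qed.

Lemma coef_Cbar k n D : (0 < k)%N -> (n <= k + D)%N ->
  Cbar k n = \sum_(d < D) (-1) ^+ d *
    (shifted_coef n (pent (k + d).+1%N%:Z) +
     shifted_coef n (pent (- (k + d).+1%:Z))).
Proof.
case: k => // k _ le_n; rewrite /Cbar subn1 /= -mulrA coef_fps_signM.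
have -> : (1 - (qpoch fps_q)^-1 * pent_sum k.+1) * prodNN =
    qgeom_prod * (qpoch fps_q - pent_sum k.+1).
  by rewrite /qgeom_prod mulrBr mulrAC mulVr ?qpoch_q_unit //; ring.
(* Up to degree [n] the infinite product may be replaced by the pentagonal sum cut at [k.+1 + D],
   leaving finitely many tail terms. *)
have Q_eqmod : fps_eqmod n.+1 (qpoch fps_q - pent_sum k.+1)
    (pent_sum (k.+1 + D)%N - pent_sum k.+1).
  by move=> m lt_m; rewrite !coef_fpsD -(@pent_sum_eqmod (k.+1 + D)%N) //; lia.
rewrite (fps_eqmodM (M := n.+1) (f' := qgeom_prod) _ Q_eqmod) //.
rewrite pent_sumD addrAC subrr add0r [qgeom_prod * _]mulr_sumr coef_fps_sum mulr_sumr.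
apply: eq_bigr => d _.
rewrite mulrCA coef_fps_signM mulrDr coef_fpsD !coef_fps_mulq.
rewrite -!/(shifted_coef _ _) mulrA -exprD; congr (_ * _).
have -> : (k + (k.+1 + d).+1 = 2 * k.+1 + d)%N by lia.
by rewrite exprD exprM sqrrN !expr1n mul1r.
Qed.

Theorem theorem2 (k : nat) (hk : (1 <= k)%N) :
  (forall n : nat, 0 <= Cbar k n) /\
  (forall n : nat, 0 < Cbar k n <-> (g k + (2 * k + 1) <= n)%N).
Proof.
have gk : (g k + (2 * k + 1) = pent k.+1%:Z)%N.
  have := pentE k.+1%:Z; have : (2 %| k * (3 * k + 1))%N.
    by rewrite dvdn2 oddM oddD oddM; case: odd.
  by move/divnK; rewrite /g; lia.
(* The indices k + d + 1 and -(k + d + 1) carry the same sign, so their terms are grouped. *)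
pose v n d : int :=
  shifted_coef n (pent (k + d).+1%N%:Z) +
    shifted_coef n (pent (- (k + d).+1%:Z)).
have v_ge0 n d : 0 <= v n d.
  rewrite addr_ge0 // /shifted_coef; case: leqP => // _;
  by rewrite ltW ?qgeom_prod_gt0.
have v_le n d : v n d.+1 <= v n d.
  rewrite /v addnS; apply: lerD; apply: shifted_coef_le.
    by rewrite pent_posS; lia.
  by rewrite pent_negS; lia.
have CbarE n : Cbar k n = \sum_(d < n.+1) (-1) ^+ d * v n d.
  by apply: coef_Cbar => //; lia.
split=> n; rewrite CbarE.
  by case/andP: (alternating_sum_bounds n.+1 (v_ge0 n) (v_le n)).
rewrite gk; split=> [|le_n].
  (* Below the threshold both exponents of the leading pair exceed [n], so the upper bound [v n 0]
     vanishes. *)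
  apply: contraLR; rewrite -ltnNge -leNgt => lt_n.
  case/andP: (alternating_sum_bounds n.+1 (v_ge0 n) (v_le n)) => _.
  move/le_trans; apply.
  rewrite /v addn0 /shifted_coef leqNgt lt_n /= add0r leqNgt.
  by rewrite (leq_trans lt_n) ?pent_pos_le_neg.
apply: lt_le_trans (alternating_sum_ge n (v_ge0 n) (v_le n)).
(* Strictness comes from the positive indices: their exponents differ by 3 (k + 1) + 1, more than
   the gap of 2 that must be exceeded. *)
rewrite subr_gt0 /v addn0 addn1; apply: ltr_leD.
  apply: shifted_coef_lt => //.
  by rewrite pent_posS; lia.
apply: shifted_coef_le.
by rewrite pent_negS; lia.
Qed.
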